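(* Let $d\ge 3$, let $M$ be a measurable space, and let $X=(X_v)_{v\in V(T_d)}$ be a factor of i.i.d. process on $M^{V(T_d)}$. Then for every infinite simple path $(v_0,v_1,v_2,\ldots)$ in $T_d$, the corresponding 1-ended tail $\sigma$-algebra is trivial with respect to the distribution of $X$.
   Context: $T_d$ is the infinite $d$-regular tree with vertex set $V(T_d)$ and automorphism group $\operatorname{Aut}(T_d)$. For a measurable space $M$, the space $M^{V(T_d)}$ carries the product $\sigma$-algebra, and $\operatorname{Aut}(T_d)$ acts on it by $(\gamma\cdot\omega)(v)=\omega(\gamma^{-1}v)$. A measurable map $F\colon[0,1]^{V(T_d)}\to M^{V(T_d)}$ is a factor if it is $\operatorname{Aut}(T_d)$-equivariant. A factor of i.i.d. process on $M^{V(T_d)}$ is $X=F(Z)$, where $F$ is such a factor and $Z=(Z_v)_{v\in V(T_d)}$ is a collection of independent random variables, each uniformly distributed on $[0,1]$. Its distribution is a probability measure on $M^{V(T_d)}$. For $V\subseteq V(T_d)$, $\sigma(V)$ denotes the $\sigma$-algebra on $M^{V(T_d)}$ generated by the coordinate projections $\pi_v\colon M^{V(T_d)}\to M$, $v\in V$. The 1-ended tail $\sigma$-algebra corresponding to an infinite simple path $(v_0,v_1,v_2,\ldots)$ is $\bigcap_{n\ge1}\sigma(D_n)$, where $D_n$ is the set of vertices of $T_d$ that are closer to $v_n$ than to $v_{n-1}$. A $\sigma$-algebra is trivial with respect to a probability measure if it contains only sets of measure $0$ or $1$. *)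

(* Defs.v *)
From HB Require Import structures.
From mathcomp Require Import all_boot all_order all_algebra finmap.
From mathcomp Require Import all_classical all_reals all_analysis.

Set Implicit Arguments.
Unset Strict Implicit.
Unset Printing Implicit Defensive.
Import Order.TTheory GRing.Theory Num.Theory.

Local Open Scope classical_set_scope.
Local Open Scope ring_scope.

(* Any connected acyclic graph all of whose vertices have exactly d
   neighbours; for d >= 2 it is infinite and unique up to isomorphism. *)
Record regular_tree (d : nat) := RegularTree {
  vertex :> choiceType;
  adj : rel vertex;
  adj_sym : symmetric adj;
  adj_irr : irreflexive adj;
  tree_connected : forall x y, exists2 p : seq vertex, path adj x p & last x p = y;
  (* [:: x; y] is a ucycle as soon as x and y are adjacent, whence the bound *)
  tree_acyclic : forall c : seq vertex, ucycle adj c -> (size c <= 2)%N;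
  tree_regular : forall x, ([set y | adj x y] #= `I_d)%card
}.

Section Tree.
Context (d : nat) (T : regular_tree d).

Definition walk_length (x y : T) : pred nat := fun n =>
  `[< exists p : seq T, [/\ path (@adj d T) x p, last x p = y & size p = n] >].

Lemma ex_walk_length (x y : T) : exists n, walk_length x y n.
Proof.
have [p xp py] := tree_connected x y.
by exists (size p); apply/asboolP; exists p.
Qed.

Definition tree_dist (x y : T) : nat := ex_minn (ex_walk_length x y).

Record automorphism := Automorphism {
  aut_fun :> T -> T;
  aut_inv : T -> T;
  aut_funK : cancel aut_fun aut_inv;
  aut_invK : cancel aut_inv aut_fun;
  aut_adj : forall x y, adj (aut_fun x) (aut_fun y) = adj x y
}.

Definition simple_ray (v : nat -> T) : Prop :=
  injective v /\ forall n, adj (v n) (v n.+1).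

(* D_n, meant for n >= 1 *)
Definition ray_side (v : nat -> T) (n : nat) : set T :=
  [set u | (tree_dist u (v n) < tree_dist u (v n.-1))%N].

End Tree.

Definition coord_cylinders {V : Type} {dM} {M : measurableType dM} (W : set V) :
    set (set (V -> M)) :=
  \bigcup_(v in W) preimage_set_system setT (fun omega : V -> M => omega v) measurable.

(* sigma(W) *)
Definition coord_sigma {V : Type} {dM} {M : measurableType dM} (W : set V) :
    set (set (V -> M)) :=
  <<s coord_cylinders W >>.

(* M^V with the product sigma-algebra, i.e. coord_sigma setT *)
Definition config (V : Type) {dM} (M : measurableType dM) :=
  g_sigma_algebraType (@coord_cylinders V dM M setT).

HB.instance Definition _ (V : Type) dM (M : measurableType dM) :=
  Measurable.on (config V M).

HB.instance Definition _ (R : realType) := isPointed.Build {i01 R} (0%:i01).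

(* [0,1] with its Borel sigma-algebra, the trace of that of R *)
Definition unit_interval (R : realType) :=
  g_sigma_algebra_preimageType (fun x : {i01 R} => x%:num : R).

HB.instance Definition _ (R : realType) := Measurable.on (unit_interval R).

Definition unit_val (R : realType) (x : unit_interval R) : R := (x : {i01 R})%:num.

Section Process.
Context (d : nat) (T : regular_tree d).

Definition aut_act (A : Type) (g : automorphism T) (omega : T -> A) : T -> A :=
  fun v => omega (aut_inv g v).

Definition is_factor (R : realType) dM (M : measurableType dM)
    (F : config T (unit_interval R) -> config T M) : Prop :=
  measurable_fun setT F /\
  forall (g : automorphism T) (omega : config T (unit_interval R)),
    F (aut_act g omega) = aut_act g (F omega).

Definition tail_sigma dM (M : measurableType dM) (v : nat -> T) :
    set (set (T -> M)) :=
  \bigcap_(n in [set n | (1 <= n)%N]) coord_sigma (ray_side v n).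

End Process.

Definition mutually_independent (R : realType) dO (Omega : measurableType dO)
    (P : probability Omega R) (V : choiceType) dE (E : measurableType dE)
    (Z : V -> {RV P >-> E}) : Prop :=
  forall (J : {fset V}) (B : V -> set E), (forall v, measurable (B v)) ->
    P (\bigcap_(v in [set` J]) (Z v @^-1` B v)) =
    (\prod_(v <- J) P (Z v @^-1` B v))%E.

Definition uniform01 (R : realType) dO (Omega : measurableType dO)
    (P : probability Omega R) (U : {RV P >-> unit_interval R}) : Prop :=
  forall B : set R, measurable B ->
    distribution P U (@unit_val R @^-1` B) = uniform_prob (@ltr01 R) B.

Definition factor_of_iid (d : nat) (T : regular_tree d) (R : realType)
    dO (Omega : measurableType dO) (P : probability Omega R)
    dM (M : measurableType dM) (X : {RV P >-> config T M}) : Prop :=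
  exists (F : config T (unit_interval R) -> config T M)
         (Z : T -> {RV P >-> unit_interval R}),
    [/\ is_factor F,
        mutually_independent Z,
        forall v, uniform01 (Z v)
      & forall w, X w = F (fun v => Z v w)].

Definition trivial_wrt (R : realType) (S : Type) (mu : set S -> \bar R)
    (G : set (set S)) : Prop :=
  forall A, G A -> mu A = 0%E \/ mu A = 1%E.

(* Main.v *)
Require Import Defs.
From mathcomp Require Import all_boot all_order all_algebra.
From mathcomp Require Import all_classical all_reals all_analysis.
From mathcomp Require Import finmap zify lra.

Import Order.TTheory GRing.Theory Num.Theory.

Local Open Scope classical_set_scope.

Set Implicit Arguments.
Unset Strict Implicit.
Unset Printing Implicit Defensive.

(** A tail event [A'] of [X = F(Z)] pulls back to a set [A = F^-1(A')] of
    labellings. If an automorphism [g] fixes every vertex of some [D_n], then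
    [g . X] and [X] agree on [D_n]; since [A'] belongs to [sigma(D_n)] and [F]
    is equivariant, [A] is invariant under [g]. For every finite set [J] of
    vertices, some such [g] moves [J] off itself: take [N] so large that
    [J] lies in the branch at [v_(N+1)] that contains [v_N]; as the degree is
    at least 3, [v_(N+1)] has a neighbour [b] other than [v_N] and [v_(N+2)],
    and the automorphism that exchanges the branches of [v_N] and [b] fixes
    [D_(N+2)] pointwise ([displacing_automorphism]).

    This invariance forces triviality ([displaced_invariant_trivial]).
    Approximate [A] up to [e] by an event [C] that depends on a finite set [J]
    of labels. The displaced event [g C] approximates [g A = A] equally well,
    has the probability of [C], and is independent of [C] because it depends on
    labels outside [J]. Hence [P(A)] is close to both [P(C)] and
    [P(C /\ g C) = P(C)^2], and [P(A) = P(A)^2] in the limit. *)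

(** * Distances and branches in a tree *)

Section TreeMetric.
Context (d : nat) (T : regular_tree d).
Implicit Types (x y z p q r c : T) (s : seq T).

Local Notation dist := (@tree_dist d T).

Lemma tree_dist_le x s : path (@adj d T) x s -> (dist x (last x s) <= size s)%N.
Proof.
move=> xs; rewrite /tree_dist; case: ex_minnP => n _; apply.
by apply/asboolP; exists s.
Qed.

Lemma tree_dist_walk x y :
  exists s, [/\ path (@adj d T) x s, last x s = y & size s = dist x y].
Proof. by rewrite /tree_dist; case: ex_minnP => n /asboolP. Qed.

Lemma tree_distxx x : dist x x = 0%N.
Proof. by have := @tree_dist_le x [::] isT => /=; case: dist. Qed.

Lemma tree_dist_eq0 x y : (dist x y == 0%N) = (x == y).
Proof.
apply/eqP/eqP => [|->]; last exact: tree_distxx.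
have [s [_ <- <-]] := tree_dist_walk x y.
by move=> /size0nil ->.
Qed.

Lemma tree_dist_gt0 x y : (0 < dist x y)%N = (x != y).
Proof. by rewrite lt0n tree_dist_eq0. Qed.

Lemma tree_dist_sym x y : dist x y = dist y x.
Proof.
suff le u v : (dist u v <= dist v u)%N by apply/eqP; rewrite eqn_leq !le.
have [s [vs <- <-]] := tree_dist_walk v u.
have : path (@adj d T) (last v s) (rev (belast v s)).
  by rewrite rev_path; under eq_path do rewrite adj_sym.
move=> /tree_dist_le; rewrite size_rev size_belast.
case: s {vs} => [|y' s] //=.
by rewrite rev_cons last_rcons.
Qed.

Lemma adj_neq x y : adj x y -> x != y.
Proof. by apply: contraTneq => ->; rewrite adj_irr. Qed.

Lemma tree_dist_adj x y r : adj x y -> (dist x r <= (dist y r).+1)%N.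
Proof.
move=> xy; have [s [ys <- <-]] := tree_dist_walk y r.
by apply: (@tree_dist_le x (y :: s)) => /=; rewrite xy.
Qed.

Lemma tree_dist1 x y : adj x y -> dist x y = 1%N.
Proof.
move=> xy; have := tree_dist_adj y xy; have := adj_neq xy.
by rewrite tree_distxx -tree_dist_gt0; lia.
Qed.

(** A walk between two neighbours of [x] that avoided [x] would close up, once
    its loops are removed, to a cycle through [x]. *)
Lemma walk_between_neighbors x p q s : adj x p -> adj x q -> p != q ->
  path (@adj d T) p s -> last p s = q -> x \in s.
Proof.
move=> xp xq pq ps lq; apply: contraT => xs.
case/shortenP: ps lq => s' ps' us' ss' lq.
have xs' : x \notin s' by apply: contra xs => /ss'.
have : ucycle (@adj d T) [:: x, p & s'].
  rewrite /ucycle /= rcons_path xp ps' lq adj_sym xq /= inE negb_or.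
  by rewrite adj_neq // xs'.
move=> /tree_acyclic; case: s' lq {ps' us' ss' xs'} => //= pq'.
by rewrite pq' eqxx in pq.
Qed.

(** Geodesics from [p] and [q] to [r] avoid [x], since passing through [x] would
    make [x] closer to [r] than they are; joined at [r], they would connect two
    distinct neighbours of [x] without meeting [x]. *)
Lemma closer_neighbor_uniq x p q r : adj x p -> adj x q ->
  (dist p r <= dist x r)%N -> (dist q r <= dist x r)%N -> p = q.
Proof.
move=> xp xq pr qr; apply/eqP; apply: contraT => pq.
have geodesic y s : path (@adj d T) y s -> last y s = r -> size s = dist y r ->
    (dist y r <= dist x r)%N -> x \notin s.
  move=> ys lr sr yr; apply/negP => xs; move: ys lr sr.
  case/splitPr: xs => s1 s2; rewrite cat_path last_cat /= => /and3P[_ _].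
  move=> /tree_dist_le lex lr; rewrite lr in lex.
  by rewrite size_cat /= => sr; lia.
have [s [ps ls ss]] := tree_dist_walk p r.
have [t [qt lt st]] := tree_dist_walk q r.
have : x \in s ++ rev (belast q t).
  apply: (walk_between_neighbors xp xq pq).
    rewrite cat_path ps ls -lt rev_path.
    by under eq_path do rewrite adj_sym.
  rewrite last_cat ls; case: t lt {qt st} => [|z t] //= lt.
  by rewrite rev_cons last_rcons.
rewrite mem_cat (negbTE (geodesic _ _ ps ls ss pr)) mem_rev /=.
move=> /mem_belast; rewrite inE (negbTE (adj_neq xq)) /=.
by rewrite (negbTE (geodesic _ _ qt lt st qr)).
Qed.

(** The next vertex on the geodesic from [x] to [r]; [r] itself when [x] is [r].
    With [r] as root it is the parent of [x]; seen from [x] it names the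
    branch at [x] that contains [r]. *)
Definition toward r x : T :=
  xget x [set y | adj x y /\ (dist y r < dist x r)%N].

Lemma towardP r x : x != r ->
  adj x (toward r x) /\ (dist (toward r x) r).+1 = dist x r.
Proof.
move=> xr.
have : [set y | adj x y /\ (dist y r < dist x r)%N] !=set0.
  have [[|y s] [/= xs ls ss]] := tree_dist_walk x r.
    by rewrite ls eqxx in xr.
  move/andP: xs => [xy ys]; exists y; split => //.
  by rewrite -ss -ls ltnS tree_dist_le.
move=> /(xgetPex x) [xt ltx]; split=> //.
by have := tree_dist_adj r xt; rewrite /toward in ltx *; lia.
Qed.

Lemma toward_root r : toward r r = r.
Proof. by apply: xgetPN => y [_]; rewrite tree_distxx. Qed.

Lemma toward_adj r x : x != r -> adj x (toward r x).
Proof. by case/towardP. Qed.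

Lemma toward_dist r x : x != r -> (dist (toward r x) r).+1 = dist x r.
Proof. by case/towardP. Qed.

Lemma toward_uniq r x y : adj x y -> (dist y r <= dist x r)%N ->
  y = toward r x.
Proof.
move=> xy yr.
have xr : x != r.
  apply: contraTneq yr => <-.
  by rewrite tree_distxx leqn0 tree_dist_eq0 eq_sym adj_neq.
have [xt td] := towardP xr.
by apply: (closer_neighbor_uniq xy xt yr); rewrite -td.
Qed.

Lemma toward_neighbor c x : adj c x -> toward c x = c.
Proof.
by move=> cx; apply/esym/toward_uniq; rewrite ?tree_distxx // adj_sym.
Qed.

Lemma toward_adj_lt r x y : adj x y -> (dist x r < dist y r)%N ->
  toward r y = x.
Proof.
by move=> xy ltxy; apply/esym/toward_uniq; rewrite 1?adj_sym // ltnW.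
Qed.

(** A tree is bipartite: [y] cannot be as far from [r] as its neighbour [x],
    because the only neighbour of [x] that is not farther is closer. *)
Lemma tree_dist_adj_neq r x y : adj x y -> dist x r != dist y r.
Proof.
move=> xy; apply/eqP => exy.
have ey : y = toward r x by apply: toward_uniq; rewrite // exy.
have [xr|xr] := eqVneq x r.
  move: exy; rewrite xr tree_distxx => /esym/eqP.
  by rewrite tree_dist_eq0 -xr eq_sym (negbTE (adj_neq xy)).
by have := toward_dist xr; rewrite -ey; lia.
Qed.

(** For [x != c], [toward x c] is the neighbour of [c] whose branch contains
    [x]: it does not change along the geodesic from [x] to [c]. *)
Lemma branch_toward c x : x != c -> toward c x != c ->
  toward (toward c x) c = toward x c.
Proof.
set p := toward c x => xc pc.
have cp : c != p by rewrite eq_sym.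
apply: toward_uniq; first exact: toward_adj.
have := toward_dist cp; have := toward_dist xc.
have := tree_dist_adj (toward p c) (toward_adj xc).
rewrite -/p (tree_dist_sym c) (tree_dist_sym c) (tree_dist_sym _ p).
by rewrite (tree_dist_sym _ x); lia.
Qed.

Lemma branch_neighbor c x : adj c x -> toward x c = x.
Proof. by move=> cx; apply: toward_neighbor; rewrite adj_sym. Qed.

Lemma branch_uniq c x y : adj c y -> (dist x y < dist x c)%N -> toward x c = y.
Proof.
move=> cy ltxy; apply/esym/toward_uniq => //.
by rewrite !(tree_dist_sym _ x) ltnW.
Qed.

Definition neighbors x : seq T := fset_set [set y | adj x y].

Lemma finite_neighbors x : finite_set [set y | adj x y].
Proof. by exists d; exact: tree_regular. Qed.

Lemma mem_neighbors x y : (y \in neighbors x) = adj x y.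
Proof.
rewrite /neighbors in_fset_set; last exact: finite_neighbors.
by apply/idP/idP => [/set_mem|xy]; last exact: mem_set.
Qed.

Lemma neighbors_uniq x : uniq (neighbors x).
Proof. exact: fset_uniq. Qed.

Lemma size_neighbors x : size (neighbors x) = d.
Proof. exact: (card_fset_set (tree_regular x)). Qed.

(** Away from the root [r], all vertices have [d.-1] children; numbering
    the children of each vertex makes all subtrees look alike. *)
Definition children r x : seq T := rem (toward r x) (neighbors x).

Lemma children_uniq r x : uniq (children r x).
Proof. exact/rem_uniq/neighbors_uniq. Qed.

Lemma size_children r x : x != r -> size (children r x) = d.-1.
Proof.
by move=> xr; rewrite size_rem ?size_neighbors// mem_neighbors toward_adj.
Qed.

Lemma mem_children r x y : y \in children r x -> adj x y /\ toward r y = x.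
Proof.
rewrite mem_rem_uniq ?neighbors_uniq// inE mem_neighbors => /andP[/= yt xy].
split=> //; apply: toward_adj_lt => //; rewrite ltnNge.
by apply: contra yt => yr; apply/eqP/toward_uniq.
Qed.

Lemma children_toward r x : x != r -> toward r x != r ->
  x \in children r (toward r x).
Proof.
move=> xr pr; rewrite mem_rem_uniq ?neighbors_uniq// inE mem_neighbors /=.
rewrite adj_sym toward_adj// andbT.
apply/eqP => ex; have := toward_dist xr; have := toward_dist pr.
by rewrite -ex; lia.
Qed.

End TreeMetric.

(** * Exchanging two branches *)

Section BranchSwap.
Context (d : nat) (T : regular_tree d) (c a b : T).
Hypotheses (ca : adj c a) (cb : adj c b).
Implicit Types x y : T.

Local Notation dist := (@tree_dist d T).

Definition swap_root x := if x == a then b else if x == b then a else x.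

Lemma swap_rootK : involutive swap_root.
Proof.
move=> x; rewrite /swap_root; have [->|xa] := eqVneq x a.
  by rewrite eqxx; case: eqVneq.
by have [->|xb] := eqVneq x b; rewrite ?eqxx// (negbTE xa) (negbTE xb).
Qed.

Lemma adj_swap_root x : adj c x -> adj c (swap_root x).
Proof. by rewrite /swap_root; do 2!case: eqP => // _. Qed.

(** The recursion is on the distance [n] from [x] to [c]. Beyond the neighbours
    of [c], a vertex keeps its number among its siblings, so that the map is
    determined by the exchange of [a] and [b] and is its own inverse. *)
Fixpoint swap_rec (n : nat) x : T :=
  match n with
  | 0 => x
  | 1 => swap_root x
  | n'.+1 => nth x (children c (swap_rec n' (toward c x)))
                   (index x (children c (toward c x)))
  end.

Definition branch_swap x := swap_rec (dist x c) x.

Lemma branch_swap_center : branch_swap c = c.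
Proof. by rewrite /branch_swap tree_distxx. Qed.

Lemma branch_swap_neighbor x : adj c x -> branch_swap x = swap_root x.
Proof. by move=> cx; rewrite /branch_swap tree_dist1// adj_sym. Qed.

Lemma branch_swap_child x : x != c -> toward c x != c ->
  branch_swap x = nth x (children c (branch_swap (toward c x)))
                        (index x (children c (toward c x))).
Proof.
move=> xc; rewrite -tree_dist_gt0 /branch_swap -(toward_dist xc).
by case: (dist (toward c x) c).
Qed.

Lemma depth_ind (P : T -> Prop) :
  P c -> (forall x, adj c x -> P x) ->
  (forall x, x != c -> toward c x != c -> P (toward c x) -> P x) ->
  forall x, P x.
Proof.
move=> Pc P1 PS x; move en : (dist x c) => n.
elim: n x en => [|n IH] x en.
  by move/eqP: en; rewrite tree_dist_eq0 => /eqP ->.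
have xc : x != c by rewrite -tree_dist_gt0 en.
have [e|tc] := eqVneq (toward c x) c.
  by apply: P1; have := toward_adj xc; rewrite e adj_sym.
by apply: PS => //; apply: IH; have := toward_dist xc; lia.
Qed.

Lemma branch_swap_toward x : x != c ->
  branch_swap x != c /\ toward c (branch_swap x) = branch_swap (toward c x).
Proof.
elim/depth_ind: x => [|x cx _|x xc tc IH _]; first by rewrite eqxx.
  rewrite branch_swap_neighbor// (toward_neighbor cx) branch_swap_center.
  by have cx' := adj_swap_root cx; rewrite eq_sym adj_neq// toward_neighbor.
have [tc' _] := IH tc.
have : branch_swap x \in children c (branch_swap (toward c x)).
  rewrite branch_swap_child// mem_nth// size_children// -(size_children tc).
  by rewrite index_mem children_toward.
move=> /mem_children[_ tx]; split=> //; apply: contraNneq tc' => e.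
by rewrite -tx e toward_root.
Qed.

Lemma branch_swapK : involutive branch_swap.
Proof.
elim/depth_ind => [|x cx|x xc tc IH]; first by rewrite !branch_swap_center.
  by rewrite !branch_swap_neighbor ?swap_rootK //; exact: adj_swap_root.
have [bxc btx] := branch_swap_toward xc.
have [btc _] := branch_swap_toward tc.
rewrite (branch_swap_child bxc) btx// IH (branch_swap_child xc tc).
have xin := children_toward xc tc.
rewrite index_uniq ?children_uniq ?nth_index//.
by rewrite size_children// -(size_children tc) index_mem.
Qed.

(** Adjacent vertices are parent and child, and the exchange commutes with
    taking parents. *)
Lemma branch_swap_adj x y : adj (branch_swap x) (branch_swap y) = adj x y.
Proof.
have swap_adj u v : adj u v -> adj (branch_swap u) (branch_swap v).
  move=> uv; wlog ltuv : u v uv / (dist u c < dist v c)%N => [H|].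
    have := tree_dist_adj_neq c uv; case: ltngtP => // ltuv _; first exact: H.
    by rewrite adj_sym; apply: H; rewrite // adj_sym.
  have vc : v != c by rewrite -tree_dist_gt0 (leq_ltn_trans _ ltuv).
  have [bvc tbv] := branch_swap_toward vc.
  by rewrite -(toward_adj_lt uv ltuv) -tbv adj_sym toward_adj.
by apply/idP/idP => /swap_adj //; rewrite !branch_swapK.
Qed.

Definition branch_swap_aut : automorphism T :=
  Automorphism branch_swapK branch_swapK branch_swap_adj.

Lemma toward_branch_swap x : x != c ->
  toward (branch_swap x) c = swap_root (toward x c).
Proof.
elim/depth_ind: x => [|x cx _|x xc tc IH _]; first by rewrite eqxx.
  rewrite branch_swap_neighbor// !branch_neighbor//; exact: adj_swap_root.
have [bxc btx] := branch_swap_toward xc.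
have [btc _] := branch_swap_toward tc.
by rewrite -(branch_toward xc tc) -(branch_toward bxc) btx // IH.
Qed.

Lemma branch_swap_fix x : toward x c != a -> toward x c != b ->
  branch_swap x = x.
Proof.
elim/depth_ind: x => [|x cx|x xc tc IH]; first by rewrite branch_swap_center.
  rewrite branch_neighbor// branch_swap_neighbor// /swap_root.
  by move=> /negbTE -> /negbTE ->.
rewrite -(branch_toward xc tc) branch_swap_child// => xa xb.
by rewrite IH// nth_index// children_toward.
Qed.

End BranchSwap.

(** * Displacing finite sets while fixing a neighbourhood of an end *)

Section Ray.
Context (d : nat) (T : regular_tree d) (v : nat -> T) (hv : simple_ray v).
Implicit Types u : T.

Local Notation dist := (@tree_dist d T).

(** Once the ray moves away from [u], turning back would give [v n.+1] a second
    neighbour closer to [u], while [v n] is already one. *)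
Lemma ray_keeps_leaving u n : (dist u (v n) < dist u (v n.+1))%N ->
  (dist u (v n.+1) < dist u (v n.+2))%N.
Proof.
case: hv => inj adjv ltn.
rewrite !(tree_dist_sym u) in ltn *; rewrite ltnNge; apply/negP => le.
have av : adj (v n.+1) (v n) by rewrite adj_sym.
have := closer_neighbor_uniq av (adjv n.+1) (ltnW ltn) le.
by move=> /inj; lia.
Qed.

(** The ray cannot approach [u] forever, since each such step decreases the
    distance, and after the first step away it never approaches again. *)
Lemma ray_leaves u : exists N, forall n, (N <= n)%N ->
  (dist u (v n) < dist u (v n.+1))%N.
Proof.
case: (hv) => inj adjv.
have [[N leN]|never] :=
    pselect (exists N, (dist u (v N) < dist u (v N.+1))%N).
  exists N => n /subnKC <-; elim: (n - N)%N => [|k IH]; first by rewrite addn0.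
  by rewrite addnS; apply: ray_keeps_leaving.
have step n : (dist u (v n.+1) < dist u (v n))%N.
  have := tree_dist_adj_neq u (adjv n); rewrite !(tree_dist_sym _ u).
  by case: ltngtP => // lt _; case: never; exists n.
have bound n : (dist u (v n) + n <= dist u (v 0))%N.
  elim: n => [|n IH]; first by rewrite addn0.
  by rewrite addnS (leq_trans _ IH)// ltn_add2r.
by have := bound (dist u (v 0)).+1; lia.
Qed.

Lemma ray_leaves_finite (J : {fset T}) : exists N, forall u, u \in J ->
  forall n, (N <= n)%N -> (dist u (v n) < dist u (v n.+1))%N.
Proof.
pose N u := projT1 (cid (ray_leaves u)).
exists (\max_(u <- J) N u) => u uJ n leN.
apply: (projT2 (cid (ray_leaves u))); apply: leq_trans leN.
exact: leq_bigmax_seq.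
Qed.

(** The automorphism exchanges, at a far vertex of the ray, the branch that
    contains [J] with a branch off the ray, which exists because [3 <= d]. *)
Lemma displacing_automorphism (J : {fset T}) : (3 <= d)%N ->
  exists (g : automorphism T) (n : nat), [/\ (1 <= n)%N,
    forall u, ray_side v n u -> aut_inv g u = u &
    forall u, u \in J -> aut_inv g u \notin J].
Proof.
move=> d3; have [inj adjv] := hv; have [N leave] := ray_leaves_finite J.
set c := v N.+1; set a := v N.
have ca : adj c a by rewrite adj_sym; apply: adjv.
have [b cb [ba bv]] : exists2 b, adj c b & b != a /\ b != v N.+2.
  have : has (fun b => (b != a) && (b != v N.+2)) (neighbors c).
    apply: contraT => /hasPn nob.
    have : (size (neighbors c) <= size [:: a; v N.+2])%N.
      apply: uniq_leq_size; first exact: neighbors_uniq.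
      by move=> x /nob; rewrite negb_and !negbK !inE.
    by rewrite size_neighbors /=; lia.
  by case/hasP => b; rewrite mem_neighbors => cb /andP[]; exists b.
exists (branch_swap_aut ca cb), N.+2; split=> // u.
  move=> side.
  have ub : toward u c = v N.+2 := branch_uniq (adjv N.+1) side.
  apply: (branch_swap_fix ca cb); rewrite ub; last by rewrite eq_sym.
  by apply/eqP => /inj; lia.
move=> uJ /=.
have J_branch x : x \in J -> x != c /\ toward x c = a.
  move=> /leave/(_ N (leqnn N)) ltx; split; last exact: branch_uniq.
  by rewrite -tree_dist_gt0 (leq_ltn_trans _ ltx).
have [uc ua] := J_branch _ uJ.
apply/negP => /J_branch[_]; rewrite toward_branch_swap// ua /swap_root eqxx.
by move=> e; rewrite e eqxx in ba.
Qed.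

End Ray.

(** * Events depending on given coordinates *)

Section Cylinders.
Context (V : choiceType) (dE : measure_display) (E : measurableType dE).
Implicit Types (W : set V) (J : {fset V}) (B : V -> set E).

Definition box J B : set (config V E) :=
  [set w | forall v, v \in J -> B v (w v)].

(** Finite-dimensional boxes are stable under intersection, unlike the
    one-coordinate cylinders that generate [coord_sigma W]; identities between
    measures need only be checked on such a generating family. *)
Definition boxes W : set (set (config V E)) :=
  [set A | exists J B, [/\ [set` J] `<=` W, forall v, measurable (B v) &
                           A = box J B]].

Lemma boxesT W : boxes W setT.
Proof.
exists fset0, (fun=> setT); split=> [v /=|//|]; first by rewrite inE.
by apply/seteqP; split.
Qed.

Lemma boxes_setI W : setI_closed (boxes W).
Proof.
move=> _ _ [J [B [JW mB ->]]] [J' [B' [JW' mB' ->]]].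
pose C v := (if v \in J then B v else setT) `&`
            (if v \in J' then B' v else setT).
exists (J `|` J')%fset, C; split.
- by move=> v /=; rewrite inE => /orP[/JW|/JW'].
- by move=> v; apply: measurableI; case: ifP.
- apply/seteqP; split=> w /=.
    by move=> [wJ wJ'] v _; split; [case: ifP => // /wJ|case: ifP => // /wJ'].
  move=> wC; split=> v vJ.
    by have [] := wC v; rewrite ?inE vJ.
  by have [] := wC v; rewrite ?inE vJ ?orbT.
Qed.

Lemma coord_sigma_sub W W' : W `<=` W' ->
  @coord_sigma V dE E W `<=` coord_sigma W'.
Proof.
move=> WW'; apply: sub_sigma_algebra2 => A [v Wv Av].
by exists v => //; exact: WW'.
Qed.

Lemma coord_sigma_measurable W :
  @coord_sigma V dE E W `<=` (@measurable _ (config V E)).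
Proof. exact: coord_sigma_sub. Qed.

Lemma coord_sigma_boxes W : @coord_sigma V dE E W = <<s boxes W>>.
Proof.
apply/seteqP; split; apply: smallest_sub; try exact: smallest_sigma_algebra.
- move=> _ [v Wv [B mB <-]]; apply: sub_sigma_algebra.
  exists [fset v]%fset, (fun=> B); split=> //.
    by move=> u /=; rewrite inE => /eqP ->.
  rewrite setTI; apply/seteqP; split=> w /= Bw.
    by move=> u; rewrite inE => /eqP ->.
  by apply: Bw; rewrite inE.
- move=> _ [J [B [JW mB ->]]].
  apply: (@fin_bigcap_measurable _
    (g_sigma_algebraType (@coord_cylinders V dE E W)) _ [set` J]
    (fun v => [set w | B v (w v)])) => // v Jv.
  apply: sub_sigma_algebra; exists v; first exact: JW.
  by exists (B v); rewrite ?setTI.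
Qed.

Lemma boxes_measurable W : boxes W `<=` (@measurable _ (config V E)).
Proof.
move=> A bA; apply: (@coord_sigma_measurable W).
by rewrite coord_sigma_boxes; apply: sub_sigma_algebra.
Qed.

Lemma measurable_config (dS : measure_display) (S : measurableType dS)
    (f : S -> config V E) :
  (forall v, measurable_fun setT (fun s => f s v)) -> measurable_fun setT f.
Proof.
move=> mf; apply: (@measurability _ _ S (config V E) setT f
  (@coord_cylinders V dE E setT)) => //.
move=> _ [_ [v _ [B mB <-]] <-]; rewrite !setTI.
by have := mf v measurableT B mB; rewrite setTI.
Qed.

Lemma measurable_coord (v : V) :
  measurable_fun setT (fun w : config V E => w v).
Proof.
move=> _ B mB; apply: sub_sigma_algebra; exists v => //.
by exists B.
Qed.

(** This is why a tail event of the factor is invariant under the automorphisms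
    that fix some [D_n] pointwise. *)
Lemma coord_sigma_agree W (A : set (V -> E)) (w w' : V -> E) :
  coord_sigma W A -> (forall v, W v -> w v = w' v) -> A w -> A w'.
Proof.
move=> WA ww'; suff -> : A w = A w' by [].
suff : @coord_sigma V dE E W `<=` [set A | A w = A w'] by apply.
apply: smallest_sub.
  split=> //= [B e|B e]; first by rewrite /setD /= e.
  by apply/propext; split=> -[k _ Bk]; exists k => //; move: Bk; rewrite e.
by move=> _ [v Wv [B mB <-]] /=; rewrite /setI/preimage /= ww'.
Qed.

Lemma coord_sigma_reindex (g : V -> V) W (A : set (config V E)) :
  coord_sigma W A ->
  coord_sigma (g @` W) ((fun w : config V E => w \o g : config V E) @^-1` A).
Proof.
set f := fun w : config V E => _; move=> WA.
suff : @coord_sigma V dE E W `<=` [set B | coord_sigma (g @` W) (f @^-1` B)].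
  exact.
have [G0 GC GU] :=
  @smallest_sigma_algebra _ setT (@coord_cylinders V dE E (g @` W)).
apply: smallest_sub; first split=> [|B /GC|B /GU] /=.
- by rewrite preimage_set0.
- by rewrite !setTD preimage_setC.
- by rewrite preimage_bigcup.
move=> _ [v Wv [B mB <-]] /=; rewrite setTI; apply: sub_sigma_algebra.
by exists (g v); [exists v|exists B; rewrite ?setTI].
Qed.

End Cylinders.

(** * A zero-one law for i.i.d. labels *)

Section ZeroOne.
Context (V : choiceType) (dE : measure_display) (E : measurableType dE).
Context (R : realType) (mu : probability (config V E) R).
Context (lambda : set E -> \bar R).
Implicit Types (W : set V) (J : {fset V}) (B : V -> set E).
Implicit Types A C : set (config V E).
Local Open Scope ereal_scope.

(* Under [mu] the labels are independent with common law [lambda]. *)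
Hypothesis mu_box : forall J B, (forall v, measurable (B v)) ->
  mu (box J B) = \prod_(v <- J) lambda (B v).

Lemma mu_box_disjoint J J' B B' : (forall v, measurable (B v)) ->
    (forall v, measurable (B' v)) -> [disjoint J & J']%fset ->
  mu (box J B `&` box J' B') = mu (box J B) * mu (box J' B').
Proof.
move=> mB mB' /fdisjointP JJ'; pose C v := if v \in J then B v else B' v.
have -> : box J B `&` box J' B' = box (J `|` J')%fset C.
  apply/seteqP; split=> w /=; rewrite /C.
    move=> [wJ wJ'] v; rewrite inE.
    by case: ifP => [/wJ //|_ /= /wJ'].
  move=> wC; split=> v vJ; have := wC v; rewrite inE vJ ?orbT => /(_ isT) //.
  by case: ifP => // /JJ'; rewrite vJ.
rewrite !mu_box//; last by move=> v; rewrite /C; case: ifP.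
have JJ : perm_eq (J `|` J')%fset (J ++ J').
  apply: uniq_perm => [||v]; first exact: fset_uniq.
    rewrite cat_uniq !fset_uniq /= andbT; apply/hasPn => v vJ'.
    by apply/negP => /JJ'; rewrite vJ'.
  by rewrite mem_cat inE.
rewrite (perm_big _ JJ) big_cat /=.
congr (_ * _); apply: eq_big_seq => v vJ; rewrite /C.
  by rewrite vJ.
by case: ifP => // /JJ'; rewrite vJ.
Qed.

(** For fixed [C], both sides are finite measures in [A], hence agree on the
    sigma-algebra as soon as they agree on a pi-system. *)
Lemma independent_generated (G : set (set (config V E))) C :
    setI_closed G -> G setT -> G `<=` measurable -> measurable C ->
    (forall A, G A -> mu (A `&` C) = mu A * mu C) ->
  forall A, <<s G>> A -> mu (A `&` C) = mu A * mu C.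
Proof.
move=> GI GT Gm mC indep A sA.
have Cfin : mu C \is a fin_num by exact: fin_num_measure.
have C0 : (0 <= fine (mu C))%R by exact: fine_ge0.
have scaleE X : mscale (NngNum C0) mu X = mu X * mu C.
  by rewrite /mscale /= fineK// muleC.
rewrite -scaleE; change (mrestr mu mC A = mscale (NngNum C0) mu A).
apply: (@g_sigma_algebra_measure_unique _ _ _ G Gm (fun=> setT) (fun=> GT))
  => //.
- by rewrite bigcup_const.
- by move=> X GX; rewrite [RHS]scaleE; exact: indep.
- by move=> _; rewrite /= /mrestr setTI ltey_eq Cfin.
Qed.

Lemma coord_sigma_independent W W' A C : W `&` W' = set0 ->
  coord_sigma W A -> coord_sigma W' C -> mu (A `&` C) = mu A * mu C.
Proof.
move=> WW' sA sC.
have sA' := sA; rewrite coord_sigma_boxes in sA'.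
apply: (independent_generated (@boxes_setI _ _ _ W) (@boxesT _ _ _ W)
  (@boxes_measurable _ _ _ W)) => //.
  exact: coord_sigma_measurable sC.
move=> {sA sA'}A bA; rewrite setIC muleC.
have sC' := sC; rewrite coord_sigma_boxes in sC'.
apply: (independent_generated (@boxes_setI _ _ _ W') (@boxesT _ _ _ W')
  (@boxes_measurable _ _ _ W')) => //.
  exact: boxes_measurable bA.
move=> {sC sC'}C [J' [B' [JW' mB' ->]]].
case: bA => J [B [JW mB ->]]; apply: mu_box_disjoint => //.
apply/fdisjointP => v /JW' W'v; apply/negP => /JW Wv.
by have : (W `&` W') v by []; rewrite WW'.
Qed.

Lemma measurable_reindex (g : V -> V) :
  measurable_fun setT (fun w : config V E => (w \o g : config V E)).
Proof. by apply: measurable_config => v; exact: measurable_coord. Qed.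

(** As all labels have the same law, moving the coordinates of a box by [g] only
    permutes the factors of its probability. *)
Lemma mu_reindex (g h : V -> V) A : cancel g h -> cancel h g -> measurable A ->
  mu ((fun w : config V E => (w \o g : config V E)) @^-1` A) = mu A.
Proof.
move=> gK hK mA; pose f (w : config V E) : config V E := w \o g.
have mf : measurable_fun setT f := measurable_reindex g.
apply: (@g_sigma_algebra_measure_unique _ _ _ (boxes setT)
  (@boxes_measurable _ _ _ setT) (fun=> setT) (fun=> @boxesT _ _ _ setT) _
  (pushforward mu f) mu) => //;
  last by rewrite -coord_sigma_boxes.
- by rewrite bigcup_const.
- exact: boxes_setI.
- move=> _ [J [B [_ mB ->]]]; rewrite /pushforward.
  change (mu (f @^-1` box J B) = mu (box J B)).
  have -> : f @^-1` box J B = box [fset g v | v in J]%fset (B \o h).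
    apply/seteqP; split=> w /= wJ v.
      by move=> /imfsetP[u /= uJ ->]; rewrite gK; exact: wJ.
    move=> vJ; have /= := wJ (g v); rewrite gK; apply.
    by apply/imfsetP; exists v.
  rewrite mu_box; last by move=> v; exact: mB.
  have gJ : perm_eq [fset g v | v in J]%fset [seq g v | v <- J].
    apply: uniq_perm => [||v]; first exact: fset_uniq.
      by rewrite (map_inj_uniq (can_inj gK)) fset_uniq.
    by apply/imfsetP/mapP => -[u uJ ->]; exists u.
  rewrite (perm_big _ gJ) big_map mu_box//.
  by apply: eq_bigr => v _; rewrite /= gK.
- by move=> _; change (mu setT < +oo); rewrite probability_setT ltry.
Qed.

(** Approximation is for the pseudo-distance [mu (A `+` C)] between events. *)
Definition approximable A := measurable A /\ forall e : R, (0 < e)%R ->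
  exists J C, coord_sigma [set` J] C /\ mu (A `+` C) <= e%:E.

Lemma measurable_setY A C : measurable A -> measurable C ->
  measurable (A `+` C).
Proof. by move=> mA mC; apply: measurableU; exact: measurableD. Qed.

Lemma setY_le A C A' C' A'' C'' : measurable A -> measurable C ->
    measurable A' -> measurable C' -> measurable A'' -> measurable C'' ->
    A'' `+` C'' `<=` (A `+` C) `|` (A' `+` C') ->
  mu (A'' `+` C'') <= mu (A `+` C) + mu (A' `+` C').
Proof.
move=> mA mC mA' mC' mA'' mC'' sub.
have mY := measurable_setY mA mC; have mY' := measurable_setY mA' mC'.
apply: le_trans (measureU2 _ mY mY').
apply: le_measure => //; apply/mem_set; first exact: measurable_setY.
exact: measurableU.
Qed.

Lemma approximable_setSD : setSD_closed approximable.
Proof.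
move=> A A' _ [mA apA] [mA' apA']; split; first exact: measurableD.
move=> e e0; have e20 : (0 < e / 2)%R by rewrite divr_gt0.
have [J [C [sC leC]]] := apA _ e20; have [J' [C' [sC' leC']]] := apA' _ e20.
have mC := coord_sigma_measurable sC; have mC' := coord_sigma_measurable sC'.
have {}sC : coord_sigma [set` (J `|` J')%fset] C.
  by apply: coord_sigma_sub sC => v /= vJ; rewrite inE vJ.
have {}sC' : coord_sigma [set` (J `|` J')%fset] C'.
  by apply: coord_sigma_sub sC' => v /= vJ; rewrite inE vJ orbT.
exists (J `|` J')%fset, (C `\` C'); split.
  exact: (@measurableD _
    (g_sigma_algebraType (@coord_cylinders V dE E [set` (J `|` J')%fset]))).
rewrite (splitr e) EFinD; apply: le_trans (leeD leC leC').
apply: setY_le => //; [exact: measurableD..|].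
by move=> w /=; have := EM (C w); have := EM (C' w); have := EM (A' w); tauto.
Qed.

Lemma approximable_ndseq : ndseq_closed approximable.
Proof.
move=> F ndF apF; have mF n : measurable (F n) := (apF n).1.
have mU : measurable (\bigcup_n F n) by exact: bigcup_measurable.
split=> // e e0; have e20 : (0 < e / 2)%R by rewrite divr_gt0.
have [n ltn] : exists n, mu ((\bigcup_n F n) `\` F n) < (e / 2)%:E.
  have cvgD : mu \o (fun n => (\bigcup_n F n) `\` F n) @ \oo --> 0.
    rewrite -(measure0 mu).
    have {1}<- : \bigcap_n ((\bigcup_n F n) `\` F n) = set0.
      by apply/seteqP; split=> // w h; have [[n _ Fn] _] := h 0%N I;
        have [_] := h n I.
    apply: nonincreasing_cvg_mu => //.
    - by rewrite ltey_eq fin_num_measure//; exact: measurableD.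
    - by move=> n; exact: measurableD.
    - by apply: bigcap_measurable => // n _; exact: measurableD.
    - move=> m n mn; apply/subsetPset; apply: setDS.
      by apply/subsetPset; exact: ndF.
  have /fine_cvgP[_ /cvgr_lt/(_ _ e20) [n _ /(_ n (leqnn n)) /= ltn]] := cvgD.
  by exists n; rewrite -lte_fin fineK ?fin_num_measure in ltn => //;
    exact: measurableD.
have [J [C [sC leC]]] := (apF n).2 _ e20.
have mC := coord_sigma_measurable sC.
exists J, C; split=> //; rewrite (splitr e) EFinD.
have le1 : mu ((\bigcup_n F n) `+` F n) <= (e / 2)%:E.
  rewrite /setY (_ : F n `\` _ = set0) ?setU0; first exact: ltW.
  by apply/seteqP; split=> // w [Fw]; apply; exists n.
apply: le_trans (leeD le1 leC); apply: setY_le => //.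
by move=> w /=; have := EM (F n w); tauto.
Qed.

(** Approximability passes to proper differences and increasing unions, which by
    the pi-lambda theorem is enough to spread it from boxes to all events. *)
Lemma measurable_approximable A : measurable A -> approximable A.
Proof.
move=> mA; suff : <<s boxes setT>> `<=` approximable.
  by apply; rewrite -coord_sigma_boxes.
apply: lambda_system_subset; [exact: boxes_setI| |..|by []].
  split=> //; [|exact: approximable_setSD|exact: approximable_ndseq].
  split=> // e e0; exists fset0, setT; split; last first.
    by rewrite setYK measure0 lee_fin ltW.
  exact: (@measurableT _
    (g_sigma_algebraType (@coord_cylinders V dE E [set` fset0]))).
move=> A' [J [B [_ mB eA]]].
have sA : coord_sigma [set` J] A'.
  by rewrite coord_sigma_boxes; apply: sub_sigma_algebra; exists J, B; split.
split; first exact: coord_sigma_measurable sA.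
by move=> e e0; exists J, A'; split=> //; rewrite setYK measure0 lee_fin ltW.
Qed.

Lemma mu_setY_le A C : measurable A -> measurable C ->
  mu A <= mu C + mu (A `+` C).
Proof.
move=> mA mC; apply: le_trans (measureU2 _ mC (measurable_setY mA mC)).
apply: le_measure; [exact/mem_set| |].
  by apply/mem_set/measurableU => //; exact: measurable_setY.
by move=> w Aw; have [Cw|nCw] := pselect (C w); [left|right; left].
Qed.

(** The bound [4 * e] collects [|a - c^2| <= 2e], from the intersection of two
    [e]-approximations of [A], and [|c^2 - a^2| <= 2 |c - a| <= 2e], where [a]
    and [c] are the probabilities of [A] and of its approximation. *)
Theorem displaced_invariant_trivial A : measurable A ->
    (forall J, exists g h : V -> V, [/\ cancel g h, cancel h g,
       forall v, v \in J -> g v \notin J &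
       (fun w : config V E => (w \o g : config V E)) @^-1` A = A]) ->
  mu A = 0 \/ mu A = 1.
Proof.
move=> mA displ.
have fA : mu A = (fine (mu A))%:E by rewrite fineK// fin_num_measure.
set a := fine (mu A) in fA.
have a0 : (0 <= a)%R by exact: fine_ge0.
have a1 : (a <= 1)%R by rewrite -lee_fin -fA probability_le1.
suff close (e : R) : (0 < e)%R -> (`|a - a * a| <= 4 * e)%R.
  have : (a * (1 - a) == 0)%R.
    rewrite mulrBr mulr1 -normr_le0; apply/ler_addgt0Pr => e e0.
    rewrite add0r (_ : e = 4 * (e / 4))%R.
      by apply: close; rewrite divr_gt0.
    by rewrite mulrC divfK.
  rewrite mulf_eq0 subr_eq0 => /orP[/eqP z|/eqP z].
    by left; rewrite fA z.
  by right; rewrite fA -z.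
move=> e0; have [J [C [sC leC]]] := (measurable_approximable mA).2 _ e0.
have [g [h [gK hK disp inv]]] := displ J.
pose f (w : config V E) : config V E := w \o g.
have mf : measurable_fun setT f := measurable_reindex g.
have mC := coord_sigma_measurable sC.
have mD : measurable (f @^-1` C).
  by rewrite -[X in measurable X]setTI; exact: mf.
have fC : mu C = (fine (mu C))%:E by rewrite fineK// fin_num_measure.
set c := fine (mu C) in fC.
have c0 : (0 <= c)%R by exact: fine_ge0.
have c1 : (c <= 1)%R by rewrite -lee_fin -fC probability_le1.
have leD : mu (A `+` (f @^-1` C)) <= e%:E.
  rewrite -{1}inv -/f (_ : _ `+` _ = f @^-1` (A `+` C)); last by [].
  by rewrite (mu_reindex gK hK)//; exact: measurable_setY.
have sD : coord_sigma (g @` [set` J]) (f @^-1` C).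
  exact: coord_sigma_reindex.
have fCD : mu (C `&` (f @^-1` C)) = (c * c)%:E.
  rewrite (coord_sigma_independent _ sC sD); last first.
    apply/seteqP; split=> // u [/= uJ [v vJ gv]].
    by have := disp _ vJ; rewrite gv uJ.
  by rewrite (mu_reindex gK hK)// fC.
have mCD : measurable (C `&` (f @^-1` C)) by exact: measurableI.
have leCD : mu (A `+` (C `&` (f @^-1` C))) <= (e + e)%:E.
  rewrite EFinD; apply: le_trans (leeD leC leD); apply: setY_le => //.
  by move=> w /=; have := EM (C w); tauto.
have upper A' C' (x y z : R) : measurable A' -> measurable C' ->
    mu A' = x%:E -> mu C' = y%:E -> mu (A' `+` C') <= z%:E -> (x <= y + z)%R.
  move=> mA' mC' xE yE zE; rewrite -lee_fin EFinD -xE -yE.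
  by apply: le_trans (mu_setY_le mA' mC') _; rewrite leeD2l.
have ac := upper _ _ _ _ _ mA mC fA fC leC.
have ca : (c <= a + e)%R by apply: (upper _ _ _ _ _ mC mA fC fA); rewrite setYC.
have acc := upper _ _ _ _ _ mA mCD fA fCD leCD.
have cca : (c * c <= a + (e + e))%R.
  by apply: (upper _ _ _ _ _ mCD mA fCD fA); rewrite setYC.
rewrite ler_norml; apply/andP; split; nra.
Qed.

End ZeroOne.

(** * Triviality of the 1-ended tail *)

Section UniformLabels.
Context (R : realType) (dO : measure_display) (Omega : measurableType dO).
Context (P : probability Omega R).

(** Every measurable set of labels is the trace of a Borel set of reals, on
    which being uniform prescribes the probability. *)
Lemma uniform01_eq_law (U U' : {RV P >-> unit_interval R})
    (B : set (unit_interval R)) : uniform01 U -> uniform01 U' -> measurable B ->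
  distribution P U B = distribution P U' B.
Proof.
move=> unifU unifU' [B0 mB0 <-]; rewrite setTI.
exact: etrans (unifU _ mB0) (esym (unifU' _ mB0)).
Qed.

End UniformLabels.

Unset Implicit Arguments.

Theorem corollary1p2 (d : nat) (hd : (3 <= d)%N) (T : regular_tree d)
  (dM : measure_display) (M : measurableType dM)
  (R : realType) (dO : measure_display) (Omega : measurableType dO)
  (P : probability Omega R) (X : {RV P >-> config T M})
  (hX : factor_of_iid X) (v : nat -> T) (hv : simple_ray v) :
  trivial_wrt (distribution P X) (tail_sigma v).
Proof.
move=> A tailA; case: hX => F [Z [[mF equivF] indepZ unifZ XE]].
have mA := coord_sigma_measurable (tailA 1%N isT).
pose z w : config T (unit_interval R) := fun u => Z u w.
have mz : measurable_fun setT z.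
  by apply: measurable_config => u; exact: measurable_funPT.
pose Z' : {mfun Omega >-> config T (unit_interval R)} :=
  mfun_Sub (mem_set mz).
have -> : distribution P X A = distribution P Z' (F @^-1` A).
  congr (P _); apply/seteqP; split=> w /=; by rewrite /preimage /= XE.
apply: (@displaced_invariant_trivial _ _ _ _ _ (distribution P (Z (v 0%N)))).
- move=> J B mB; rewrite -[LHS]/(P (\bigcap_(u in [set` J]) (Z u @^-1` B u))).
  rewrite indepZ//; apply: eq_bigr => u _.
  exact: (uniform01_eq_law (unifZ u) (unifZ (v 0%N)) (mB u)).
- by rewrite -[X in measurable X]setTI; exact: mF.
- move=> J; have [g [n [n1 fixg dispg]]] := displacing_automorphism hv J hd.
  (* the action of [g] reads the labelling at [aut_inv g u] *)
  exists (aut_inv g), g; split=> //; [exact: aut_invK|exact: aut_funK|].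
  have agree := coord_sigma_agree (tailA n n1).
  apply/seteqP; split=> w; rewrite /preimage /= -/(aut_act g w) equivF.
    by apply: agree => u /fixg; rewrite /aut_act => ->.
  by apply: agree => u /fixg; rewrite /aut_act => ->.
Qed.
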